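(* Let $c=1/\sqrt{2}$, $d=2(\sqrt{2}-1)$, $a(n)=\lfloor cn+d\rfloor$ for $n\in\mathbb{Z}$, $f(n)=a(n)+a(n-1)$, $\theta_n=\{cn+d\}$, $\delta(n)=a(f(n))-n$, and $\mathcal{D}=\{n\ge 1:\ \delta(n)=1\}$. Then for every integer $n\ge 2$, \[ \delta(n)=1\iff \theta_{n-1}\in[1-c,\,1/2]. \] Consequently: (a) every $n\in\mathcal{D}$ satisfies $a(n+1)=a(n)$; (b) $\mathcal{D}$ has natural density $c-\tfrac12=\frac{\sqrt{2}-1}{2}$.
   Context: $\{x\}=x-\lfloor x\rfloor$ denotes the fractional part. The natural density of $A\subseteq\mathbb{Z}_{\ge1}$ is $\lim_{N\to\infty}\#(A\cap[1,N])/N$. *)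

(* Defs.v *)
From HB Require Import structures.
From mathcomp Require Import all_boot all_order all_algebra.
From mathcomp Require Import all_classical all_reals all_analysis.

Set Implicit Arguments.
Unset Strict Implicit.
Unset Printing Implicit Defensive.

Import Order.TTheory GRing.Theory Num.Theory.
Import numFieldNormedType.Exports.

Local Open Scope classical_set_scope.
Local Open Scope ring_scope.

Definition frac (R : realType) (x : R) : R := x - (Num.floor x)%:~R.

Definition c (R : realType) : R := 1 / Num.sqrt 2.
Definition d (R : realType) : R := 2 * (Num.sqrt 2 - 1).

(* The sequences below are integer-valued; [R] only records which model of the
   reals is used to compute the floor. *)
Definition a (R : realType) (n : int) : int := Num.floor (c R * n%:~R + d R).
Definition f (R : realType) (n : int) : int := a R n + a R (n - 1).
Definition theta (R : realType) (n : int) : R := frac (c R * n%:~R + d R).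
Definition delta (R : realType) (n : int) : int := a R (f R n) - n.
Definition calD (R : realType) : set int := [set n | 1 <= n /\ delta R n = 1].

Definition count_upto (A : set int) (N : nat) : nat :=
  count (fun k : nat => k%:Z \in A) (index_iota 1 N.+1).

(* The quotient at [N = 0] is [0 / 0 = 0], which does not affect the limit. *)
Definition has_natural_density (R : realType) (A : set int) (l : R) : Prop :=
  (count_upto A N)%:R / N%:R @[N --> \oo] --> l.

(* Main.v *)
(* Put e = 1 if theta_{n-1} >= 1 - c and e = 0 otherwise, so that
   f(n) = 2 a(n-1) + e.  Since 2c = sqrt 2, 2c^2 = 1 and (1 + sqrt 2) d = 2,
   c f(n) + d = n + 1 - sqrt 2 theta_{n-1} + c e, and delta(n) can be read off.

   For the density, D counts theta_m >= 1 - c minus theta_m > 1/2.  If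
   c k = r + h with r an integer and 0 <= h < 1, then the indicator of
   theta_m >= 1 - h is a(m+k) - a(m) - r, whose sum telescopes to h N up to an
   error at most k.  This settles the threshold 1 - c (k = 1).  The threshold 1/2
   is squeezed between thresholds 1 - h with h close to 1/2: writing
   (1 - sqrt 2)^j = p - k sqrt 2 with p = 2r + 1 odd (Pell), one has
   c k = r + 1/2 - (1 - sqrt 2)^j / 2, and the sign alternates with j. *)
Require Import Defs.
From HB Require Import structures.
From mathcomp Require Import all_boot all_order all_algebra.
From mathcomp Require Import all_classical all_reals all_analysis.
From mathcomp Require Import lra ring zify.

Set Implicit Arguments.
Unset Strict Implicit.
Unset Printing Implicit Defensive.

Import Order.TTheory GRing.Theory Num.Theory.
Import numFieldNormedType.Exports.

Local Open Scope classical_set_scope.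
Local Open Scope ring_scope.

(** Induction on [k]: passing to [k + 1] adds [u (m + k + 1) - u (m + k)] to each term on the left,
    and these increments telescope over [m] to [u (N + k) - u k]. *)
Lemma sum_shift_sub (V : zmodType) (u : nat -> V) (N k : nat) :
  \sum_(m < N) (u (m + k)%N - u m) = \sum_(i < k) (u (N + i)%N - u i).
Proof.
elim: k => [|k IHk].
  by rewrite big_ord0 big1 // => m _; rewrite addn0 subrr.
rewrite big_ord_recr /= -IHk -[u k](congr1 u (add0n k)).
rewrite -(telescope_sumr (fun m => u (m + k)%N) (leq0n N)) big_mkord -big_split /=.
by apply: eq_bigr => m _; rewrite addnS addSn addrC subrKA.
Qed.

Lemma frac_itv (R : realType) (x : R) : 0 <= Defs.frac x < 1.
Proof.
have /andP[h1 h2] := floor_itv x; rewrite intrD in h2.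
rewrite /Defs.frac; lra.
Qed.

(** [frac x + h] lies in [[0, 2)], so a carry of 1 occurs exactly when it reaches 1. *)
Lemma floorD_frac (R : realType) (x h : R) (r : int) : 0 <= h < 1 ->
  Num.floor (x + (r%:~R + h)) = Num.floor x + r + (1 - h <= Defs.frac x)%R%:R.
Proof.
move=> h01; have := frac_itv x; rewrite /Defs.frac => x01.
apply: floor_def; rewrite !intrD.
by case: (lerP (1 - h)) => hx /=; rewrite ?mulr1z ?mulr0z; lra.
Qed.

Lemma sum_frac_ge_bound (R : realType) (alpha beta h : R) (k : nat) (r : int)
    (N : nat) : 0 <= h < 1 -> alpha * k%:R = r%:~R + h ->
  `|\sum_(m < N) (1 - h <= Defs.frac (alpha * m%:R + beta))%R%:R - h * N%:R|
    <= k%:R.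
Proof.
move=> h01 hk; pose u (m : nat) : R := (Num.floor (alpha * m%:R + beta))%:~R.
have bE (m : nat) : (1 - h <= Defs.frac (alpha * m%:R + beta))%R%:R
    = u (m + k)%N - u m - r%:~R :> R.
  rewrite /u natrD mulrDr hk (addrAC _ (r%:~R + h)) floorD_frac // !intrD.
  by case: (1 - h <= _); rewrite /= ?mulr1z ?mulr0z; ring.
under eq_bigr do rewrite bE.
rewrite big_split /= sum_shift_sub sumr_const card_ord.
(* As [alpha * k = r + h], the total [(r + h) * N] splits into [k] shares [alpha * N], one per
   boundary term. Each term is then a difference of two fractional parts, hence below 1 in absolute
   value. *)
have -> : \sum_(i < k) (u (N + i)%N - u i) + (- r%:~R) *+ N - h * N%:R
    = \sum_(i < k) (u (N + i)%N - u i - alpha * N%:R).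
  rewrite [RHS]big_split /= sumr_const card_ord -[in LHS]mulr_natr -[in RHS]mulr_natr.
  ring: hk.
apply: le_trans (ler_norm_sum _ _ _) _.
rewrite -[k in leRHS]card_ord -sumr_const; apply: ler_sum => i _.
rewrite /u natrD mulrDr.
have := floor_itv (alpha * i%:R + beta).
have := floor_itv (alpha * N%:R + alpha * i%:R + beta).
rewrite !intrD ler_norml; lra.
Qed.

Lemma natural_density_bounds (R : realType) (A : set int) (l : R) :
  (forall e : R, 0 < e -> exists K : R, forall N : nat,
     `|(Defs.count_upto A N)%:R - l * N%:R| <= e * N%:R + K) ->
  Defs.has_natural_density A l.
Proof.
move=> hA; apply/cvgrPdist_le => e e0.
have [K hK] := hA (e / 2) ltac:(lra).
near=> N.
have N0 : 0 < N%:R :> R by rewrite ltr0n; near: N; exact: nbhs_infty_gt.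
have KN : K * 2 / e <= N%:R by near: N; exact: nbhs_infty_ger.
have {}KN : K <= (e / 2) * N%:R by rewrite ler_pdivrMr // in KN; lra.
have := hK N; set w := (_%:R) => hw.
rewrite distrC -(ler_pM2r N0) -[X in _ * X <= _](gtr0_norm N0) -normrM.
by rewrite mulrBl divfK ?gt_eqF //; lra.
Unshelve. all: by end_near.
Qed.

(** For nonzero [x] and [y], the exponent of 2 is even in [x ^+ 2] and odd in [2 * y ^+ 2]. *)
Lemma sqr_eq_2sqr (x y : int) : x ^+ 2 = 2 * y ^+ 2 -> x = 0.
Proof.
move=> /(congr1 absz); rewrite abszM !abszX /= => xy.
apply/eqP; rewrite -absz_eq0 -[_ == _]negbK -lt0n; apply/negP => x0.
have y0 : (0 < `|y|)%N by case: (`|y|)%N xy => // xy; rewrite muln0 in xy; lia.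
have := congr1 (logn 2) xy; rewrite lognM ?expn_gt0 ?y0 // !lognX.
rewrite (_ : logn 2 2 = 1%N) //; lia.
Qed.

Section Sqrt2.
Variable R : realType.
Local Notation s := (Num.sqrt 2 : R).
Local Notation theta := (Defs.theta R).
Local Notation a := (Defs.a R).

Lemma sqrt2_sqr : s * s = 2.
Proof. by rewrite -expr2 sqr_sqrtr. Qed.

Lemma sqrt2_bounds : 7 / 5 < s < 3 / 2.
Proof. have s0 : 0 <= s := sqrtr_ge0 _; have := sqrt2_sqr; nra. Qed.

Lemma cE : Defs.c R = s / 2.
Proof.
have sb := sqrt2_bounds; apply: (@mulIf _ s); first by lra.
by rewrite /Defs.c divfK; [have := sqrt2_sqr; lra | lra].
Qed.

Lemma theta_itv (n : int) : 0 <= theta n < 1.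
Proof. exact: frac_itv. Qed.

Lemma aE (n : int) : (a n)%:~R = Defs.c R * n%:~R + Defs.d R - theta n.
Proof. by rewrite /Defs.theta /Defs.frac -/(a n) subKr. Qed.

Lemma a_step (n : int) : a (n + 1) = a n + (1 - Defs.c R <= theta n)%R%:R.
Proof.
have sb := sqrt2_bounds.
have c01 : 0 <= Defs.c R < 1 by rewrite cE; lra.
rewrite /a intrD mulrDr mulr1 addrAC -[X in _ + X]add0r -[0]/(0%:~R).
by rewrite floorD_frac // addr0.
Qed.

(* If [theta n = 0] then [sqrt 2 * (n + 4) = 2 * (a n + 2)], against the
   irrationality of [sqrt 2]. *)
Lemma theta_gt0 (n : int) : n != -4 -> 0 < theta n.
Proof.
move=> n4; have /andP[t0 _] := theta_itv n; rewrite lt_neqAle t0 andbT eq_sym.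
apply: contra_neq n4 => tz; have := aE n; rewrite tz cE /Defs.d => aE0.
have sq : 2 * (a n + 2) = 0.
  apply: (@sqr_eq_2sqr _ (n + 4)); apply: (@intr_inj R).
  rewrite !(rmorphXn, rmorphM, rmorphD) /= aE0.
  by field: sqrt2_sqr.
have {sq}a2 : a n = -2 by lia.
have sb := sqrt2_bounds.
apply: (@intr_inj R); rewrite a2 in aE0.
apply: (@mulfI _ s); first by lra.
by rewrite !mulrNz /= in aE0 *; lra.
Qed.

Lemma delta_eq1 (n : int) : n != -4 ->
  Defs.delta R (n + 1) = 1 <-> 1 - Defs.c R <= theta n <= 1 / 2.
Proof.
move=> n4; have t0 := theta_gt0 n4; have /andP[_ t1] := theta_itv n.
have sb := sqrt2_bounds; have ss := sqrt2_sqr.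
pose e : int := (1 - Defs.c R <= theta n)%R%:R.
have fE : Defs.f R (n + 1) = 2 * a n + e.
  by rewrite /Defs.f addrK a_step -/e; ring.
have vE : Defs.c R * (Defs.f R (n + 1))%:~R + Defs.d R
    = n%:~R + 2 - s * theta n + Defs.c R * e%:~R.
  by rewrite fE intrD intrM aE cE /Defs.d; field: ss.
have -> : Defs.delta R (n + 1) = 1 <->
    (n + 2)%:~R <= n%:~R + 2 - s * theta n + Defs.c R * e%:~R
      < (n + 2 + 1)%:~R.
  rewrite -vE /Defs.delta; split=> [h|/floor_def h].
    by rewrite (_ : n + 2 = a (Defs.f R (n + 1))) ?floor_itv //; lia.
  by rewrite /Defs.a h; lia.
(* If [e = 1], the lower bound says [theta n <= 1 / 2] and the upper one is automatic. If [e = 0],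
   the lower bound fails because [theta n > 0]; this is where [n != -4] matters, since
   [theta (-4) = 0]. *)
rewrite !intrD /e cE; case: (lerP (1 - _)) => ht /=; split; nra.
Qed.

Lemma pell_half (j : nat) :
  exists k r : nat, Defs.c R * k%:R = r%:R + (1 - (1 - s) ^+ j) / 2.
Proof.
elim: j => [|j [k [r IH]]].
  by exists 0, 0; rewrite expr0 mulr0; lra.
(* Multiplying [(2 r + 1) - k s] by [1 - s] gives [(2 (r + k) + 1) - (2 r + 1 + k) s]. *)
exists (r + r + 1 + k)%N, (r + k)%N.
rewrite exprS !natrD; rewrite cE in IH *.
have ss := sqrt2_sqr.
have -> : (1 - s) ^+ j = 1 + 2 * r%:R - s * k%:R by lra.
by field: ss.
Qed.

Lemma sum_theta_gt_half (e : R) : 0 < e -> exists K : R, forall N : nat,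
  `|\sum_(m < N) (1 / 2 < theta m%:Z)%R%:R - 1 / 2 * N%:R| <= e * N%:R + K.
Proof.
move=> e0; have sb := sqrt2_bounds.
pose z : R := (1 - s) ^+ 2.
have z01 : 0 < z < 1 by rewrite /z expr2; nra.
have [j zj] : exists j, z ^+ j < e.
  have /cvgrPdist_lt/(_ _ e0)[j _ /(_ j (leqnn j))] : z ^+ n @[n --> \oo] --> (0 : R).
    by apply: cvg_expr; rewrite gtr0_norm; lra.
  rewrite /= sub0r normrN gtr0_norm => [?|]; last by apply: exprn_gt0; lra.
  by exists j.
have zj0 : 0 < z ^+ j by apply: exprn_gt0; lra.
have zj1 : z ^+ j <= 1 by apply: exprn_ile1; lra.
have szj : 0 < (s - 1) * z ^+ j <= z ^+ j / 2 by nra.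
have [k1 [r1]] := pell_half (2 * j); rewrite exprM -/z => h1.
have [k2 [r2]] := pell_half (2 * j).+1; rewrite exprS exprM -/z => h2.
exists (k1%:R + k2%:R) => N.
have := sum_frac_ge_bound (r := r1) (Defs.d R) N _ h1.
have := sum_frac_ge_bound (r := r2) (Defs.d R) N _ h2.
set S1 := \sum_(m < N) _; set S2 := \sum_(m < N) _; set S := \sum_(m < N) _.
(* [S2] comes from the even exponent, whose threshold [(1 + z ^+ j) / 2] exceeds 1/2; [S1] comes
   from the odd one, whose threshold lies below 1/2. *)
have S12 : S2 <= S <= S1.
  apply/andP; split; apply: ler_sum => m _; rewrite ler_nat.
    rewrite -[Defs.frac _]/(theta m%:Z).
    case: (lerP (1 - _)) => //; case: (ltrP (1 / 2)) => // /=; lra.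
  rewrite -[Defs.frac _]/(theta m%:Z).
  case: (ltrP (1 / 2)) => //; case: (lerP (1 - _)) => // /=; lra.
move=> /(_ ltac:(lra)) + /(_ ltac:(lra)).
have k1p : 0 <= k1%:R :> R := ler0n _ _.
have k2p : 0 <= k2%:R :> R := ler0n _ _.
have Np : 0 <= N%:R :> R := ler0n _ _.
rewrite !ler_norml; nra.
Qed.

Lemma count_calD (N : nat) :
  (Defs.count_upto (Defs.calD R) N)%:R
  = \sum_(m < N) (1 - Defs.c R <= theta m%:Z)%R%:R
    - \sum_(m < N) (1 / 2 < theta m%:Z)%R%:R :> R.
Proof.
have sb := sqrt2_bounds.
rewrite /Defs.count_upto -sum1_count big_mkcond big_add1 /= big_mkord natr_sum.
rewrite -sumrB; apply: eq_bigr => m _.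
have -> : (m.+1%:Z \in Defs.calD R) = (1 - Defs.c R <= theta m%:Z <= 1 / 2).
  rewrite (_ : m.+1%:Z = m%:Z + 1); last by lia.
  apply/idP/idP; rewrite in_setE /Defs.calD /=.
    by case=> _ /(delta_eq1 (n := m%:Z)) ->; lia.
  by move=> h; split; [lia | apply/delta_eq1 => //; lia].
(* As [1 - c < 1 / 2], the second indicator never exceeds the first, and their difference is the
   indicator of the closed interval. *)
rewrite cE; case: (lerP (1 - _)); case: (lerP _ (1 / 2)) => /=; lra.
Qed.

Lemma density_calD :
  Defs.has_natural_density (Defs.calD R) (Defs.c R - 1 / 2).
Proof.
have sb := sqrt2_bounds.
apply: natural_density_bounds => e e0.
have [K hK] := sum_theta_gt_half e0; exists (K + 1) => N.
have := @sum_frac_ge_bound R (Defs.c R) (Defs.d R) (Defs.c R) 1 0 N.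
rewrite mulr1 add0r cE => /(_ ltac:(lra) erefl); rewrite -cE.
have := hK N; rewrite count_calD.
rewrite -[X in _ -> `|X - _| <= 1%:R -> _]/(\sum_(m < N) (1 - Defs.c R <= theta m%:Z)%R%:R).
rewrite !ler_norml; lra.
Qed.

End Sqrt2.

Theorem theorem6p1 (R : realType) :
  (forall n : int, 2 <= n ->
     (Defs.delta R n = 1 <->
      Defs.theta R (n - 1) \in `[1 - Defs.c R, 1 / 2])) /\
  (forall n : int, Defs.calD R n -> Defs.a R (n + 1) = Defs.a R n) /\
  Defs.has_natural_density (Defs.calD R) (Defs.c R - 1 / 2) /\
  Defs.c R - 1 / 2 = (Num.sqrt 2 - 1) / 2.
Proof.
have sb := sqrt2_bounds R.
have deltaE (n : int) : 1 <= n -> Defs.delta R n = 1 <->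
    1 - Defs.c R <= Defs.theta R (n - 1) <= 1 / 2.
  by move=> n1; rewrite -delta_eq1 ?subrK //; lia.
split=> [n n2|]; first by rewrite in_itv /=; apply: deltaE; lia.
split=> [n [n1 /(deltaE n n1) th]|]; last first.
  by split; [exact: density_calD | rewrite cE; lra].
have th1 := theta_itv R (n - 1).
have aS := a_step R (n - 1); rewrite subrK (andP th).1 in aS.
(* Since [a] jumps from [n - 1] to [n], [theta n = theta (n - 1) + c - 1 <= c - 1 / 2]. This is
   below [1 - c] because [2 c = s < 3 / 2], so [a] cannot jump again. *)
have := aE R n; have := aE R (n - 1).
rewrite a_step aS !intrD mulrNz cE => e1 e2; case: lerP => [h|]; last by rewrite addr0.
exfalso; rewrite cE in th h; rewrite /= in e2; lra.
Qed.
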